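(* Let $\mathfrak{V}$ be a nontrivial exact finitely generated linked net of vector spaces of dimension $r+1$ over a $\mathbb{Z}^n$-quiver $Q$, and let $H$ be its minimum set of generators. Then, for each $v\in H$ and each $m$-partition $\pi=(\pi_1,\dots,\pi_m)$ of $H$ such that $\mathbf{P}_{v,\pi}\cap\mathring{\Omega}_{r+1}\neq\emptyset$, there is an $m$-gon $\Delta\subseteq H$ such that $v\in\Delta$ and the ordered partition of $H$ induced by $\Delta$ and $v$ coincides with $\pi$. In particular, $\mathbf{P}_{v,\pi}=\mathbf{P}_\Delta$.
   Context: **$\mathbb{Z}^n$-quivers.** Let $Q$ be a quiver and $T$ a partition of its arrow set into $n+1$ nonempty parts, called arrow types. For a path $\gamma$ and $\mathfrak{a}\in T$, $\mathbf{t}_\gamma(\mathfrak{a})$ is the number of arrows of type $\mathfrak{a}$ in $\gamma$; the essential type is $\mathrm{Ess}(\gamma)=\{\mathfrak a\in T:\mathbf t_\gamma(\mathfrak a)>0\}$. The path $\gamma$ is admissible if $\mathbf{t}_\gamma(\mathfrak{a})=0$ for some $\mathfrak a$, and simple if $\mathbf{t}_\gamma(\mathfrak{a})\le 1$ for all $\mathfrak a$. Trivial paths are allowed. $Q$ (with $T$) is a $\mathbb{Z}^n$-quiver if: (1) exactly one arrow of each type leaves each vertex; (2) each vertex is connected to each other by an admissible path; (3) two paths $\gamma_1,\gamma_2$ leaving the same vertex arrive at the same vertex if and only if $\mathbf{t}_{\gamma_1}-\mathbf{t}_{\gamma_2}$ is a constant function on $T$. A simple non-admissible path is a circuit, called a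 minimal circuit. Two distinct vertices connected by a simple path are neighbors. If a simple path of essential type $I$ connects $v_1$ to $v_2$, write $v_2=I\cdot v_1$. The hull $P(H)$ of a set $H$ of vertices is the set of vertices $v$ such that for each arrow type there are $z\in H$ and a path from $z$ to $v$ containing no arrow of that type. **Polygons and shadows.** If $P(H)=H\neq\emptyset$, for each vertex $u$ of $Q$ there is a unique $w_u\in H$, the shadow of $u$ in $H$, such that for every $z\in H$ there is an admissible path from $z$ to $u$ passing through $w_u$. For $v\in H$, $R_v^H$ is the set of vertices of $Q$ whose shadow in $H$ is $v$. An $m$-gon is a set of $m$ pairwise neighboring vertices of $Q$ (a polygon); every polygon $\Delta$ satisfies $P(\Delta)=\Delta$. Vertices $v_1,\dots,v_m$ form an oriented $m$-gon if there is an ordered partition $T=I_1\cup\cdots\cup I_m$ into nonempty parts with $v_{i+1}=I_i\cdot v_i$ for $i=1,\dots,m-1$. For an $m$-gon $\Delta$ and $v\in\Delta$ there is a unique ordering $v_1,\dots,v_m$ of $\Delta$ with $v_1=v$ forming an oriented $m$-gon; the ordered partition of $H$ induced by $\Delta$ and $v$ is $(\pi_1,\dots,\pi_m)$ with $\pi_i=R_{v_i}^\Delta\cap H$. An $m$-partition of $H$ is an ordered partition of $H$ into $m$ nonempty parts. **Linked nets.** Let $\mathbf{k}$ be a field. For a representation $\mathfrak{V}$ of $Q$ in finite-dimensional $\mathbf{k}$-vector spaces, $V_v$ is the space at vertex $v$ and $\varphi_\gamma$ is the composition of the maps along the path $\gamma$ ($\varphi_\gamma=\mathrm{id}$ for trivial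 $\gamma$). $\mathfrak{V}$ is a linked net if: (1) for paths $\gamma_1,\gamma_2$ connecting the same two vertices with $\gamma_2$ admissible, $\varphi_{\gamma_1}$ is a scalar multiple of $\varphi_{\gamma_2}$; (2) $\varphi_\gamma=0$ for each minimal circuit $\gamma$; (3) if $\gamma_1,\gamma_2$ are admissible paths leaving the same vertex with no arrow type in common, then $\ker\varphi_{\gamma_1}\cap\ker\varphi_{\gamma_2}=0$. Write $\varphi^{u}_{w}$ for $\varphi_\gamma$, well defined up to nonzero scalar, with $\gamma$ any admissible path from $u$ to $w$. $\mathfrak{V}$ is exact if $\mathrm{Im}(\varphi^{u}_{w})=\ker(\varphi^{w}_{u})$ for all neighbors $u,w$. $\mathfrak V$ is of dimension $r+1$ if $\dim V_v=r+1$ for all $v$; nontrivial means the $V_v$ are nonzero. $\mathfrak{V}$ is $1$-generated by a set $H$ of vertices if for each vertex $v$ there are $w\in H$ and a path $\gamma$ from $w$ to $v$ with $\varphi_\gamma$ surjective. $\mathfrak{V}$ is finitely generated if there is a finite set $H$ of vertices such that each $V_v$ is the sum of finitely many images $\varphi_{\gamma_i}(V_{w_i})$, with $w_i\in H$ and $\gamma_i$ a path from $w_i$ to $v$; in this case it is $1$-generated by a finite set. The minimum set of generators $H$ of such an exact nontrivial $\mathfrak{V}$ is the intersection of all sets of vertices $1$-generating $\mathfrak{V}$; it satisfies $P(H)=H$. **Polytopes.** For $q\in\mathbf{R}^H$ and $I\subseteq H$ put $q(I)=\sum_{v\in I}q(v)$. For a supermodular $\mu:2^H\to\mathbf{R}$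 ($\mu(\emptyset)=0$, $\mu(I_1)+\mu(I_2)\le\mu(I_1\cup I_2)+\mu(I_1\cap I_2)$), let $\mu^*(I)=\mu(H)-\mu(H\setminus I)$ and $\mathbf{P}_\mu=\{q\in\mathbf{R}^H:\mu(I)\le q(I)\le\mu^*(I)\ \forall I\subseteq H\}$. For an ordered partition $\pi=(\pi_1,\dots,\pi_s)$ of $H$ with $F_j=\pi_1\cup\dots\cup\pi_j$, $F_0=\emptyset$, the splitting of $\mu$ is $$\mu_\pi(I)=\sum_{j=1}^s\big(\mu((I\cap F_j)\cup F_{j-1})-\mu(F_{j-1})\big).$$ For $v\in H$ let $\mu_v(I)=\dim\bigcap_{u\in H\setminus I}\ker(\varphi^v_u)$ (empty intersection $=V_v$); it is supermodular. Put $\mathbf{P}_v=\mathbf{P}_{\mu_v}$, $\mu_{v,\pi}=(\mu_v)_\pi$, and $\mathbf{P}_{v,\pi}=\mathbf{P}_{\mu_{v,\pi}}$, a face of $\mathbf{P}_v$. Let $\Omega_{r+1}=\{q\in\mathbf{R}^H:q(v)\ge0\ \forall v,\ q(H)=r+1\}$; $\mathring{\ }$ denotes relative interior. **The polytope of a polygon.** Fix for each $v,u\in H$ an admissible path $\gamma^v_u$ from $v$ to $u$. Let $U=\bigoplus_{u\in H}V_u$. For a polygon $\Delta\subseteq H$ let $$V_\Delta=\bigoplus_{v\in\Delta}\Big(\bigcap_{w\in H\setminus R_v^\Delta}\ker(\varphi^v_w)\Big)$$ and let $W_\Delta\subseteq U$ be the image of $V_\Delta\to U$, $(s_v)_{v\in\Delta}\mapsto\big(\varphi_{\gamma^{w_u}_u}(s_{w_u})\big)_{u\in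 H}$, where $w_u$ is the shadow of $u$ in $\Delta$. For a subspace $W\subseteq U$, $\mu_W(I)=\dim\big(W\cap\bigoplus_{u\in I}V_u\big)$, which is supermodular. Put $\mu_\Delta=\mu_{W_\Delta}$ and $\mathbf{P}_\Delta=\mathbf{P}_{\mu_\Delta}$. *)

(* Defs.v *)
From HB Require Import structures.
From mathcomp Require Import all_boot all_order all_algebra.
From mathcomp Require Import finmap.
From mathcomp Require Import boolp classical_sets reals.

Set Implicit Arguments.
Unset Strict Implicit.
Unset Printing Implicit Defensive.

Import Order.TTheory GRing.Theory Num.Theory.

(* The arrow set is the disjoint union of the arrow u v; the partition into
   n + 1 types is the fibre partition of atype (see Zn_quiver for nonemptiness
   of the parts). *)
Record typed_quiver (n : nat) := TypedQuiver {
  vertex :> choiceType;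
  arrow : vertex -> vertex -> Type;
  atype : forall u v : vertex, arrow u v -> 'I_n.+1
}.

Section Paths.
Variables (n : nat) (Q : typed_quiver n).
Implicit Types (u v w z : Q) (t : 'I_n.+1).

Inductive qpath : Q -> Q -> Type :=
| qnil v : qpath v v
| qcons u v w : arrow u v -> qpath v w -> qpath u w.

Fixpoint qcat u v w (p : qpath u v) : qpath v w -> qpath u w :=
  match p in qpath u v return qpath v w -> qpath u w with
  | qnil _ => fun q => q
  | qcons _ _ _ a p' => fun q => qcons a (qcat p' q)
  end.

Fixpoint ptype u v (p : qpath u v) (t : 'I_n.+1) : nat :=
  match p with
  | qnil _ => 0
  | qcons _ _ _ a p' => (atype a == t) + ptype p' t
  end.

Definition Ess u v (p : qpath u v) : {set 'I_n.+1} := [set t | 0 < ptype p t].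

Definition admissible u v (p : qpath u v) := [exists t, ptype p t == 0].

Definition simple_path u v (p : qpath u v) := [forall t, ptype p t <= 1].

Definition minimal_circuit u v (p : qpath u v) :=
  simple_path p && ~~ admissible p.

Definition Zn_quiver : Prop :=
  [/\ forall t, exists u v (a : arrow u v), atype a = t,
      forall u t, exists! b : {v : Q & arrow u v}, atype (projT2 b) = t,
      forall u v, u != v -> exists p : qpath u v, admissible p
    & forall u v w (p : qpath u v) (q : qpath u w),
        v = w <->
        exists c : int, forall t, ((ptype p t)%:Z - (ptype q t)%:Z = c)%R].

Definition neighbors u v : Prop :=
  u != v /\ exists p : qpath u v, simple_path p.

(* v = I . u *)
Definition moved (I : {set 'I_n.+1}) u v : Prop :=
  exists p : qpath u v, simple_path p /\ Ess p = I.

Local Open Scope fset_scope.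

(* w is the shadow of u in D *)
Definition is_shadow (D : {fset Q}) u w : Prop :=
  w \in D /\ forall z, z \in D ->
    exists (p : qpath z w) (q : qpath w u), admissible (qcat p q).

Definition polygon (m : nat) (D : {fset Q}) : Prop :=
  #|` D| = m /\ {in D &, forall u v, u != v -> neighbors u v}.

End Paths.

Section OrderedPartitions.
Variables (E : finType) (m : nat).

Definition ordered_partition (pi : m.-tuple {set E}) : Prop :=
  [/\ forall i, tnth pi i != finset.set0,
      forall i j, i != j -> [disjoint tnth pi i & tnth pi j]
    & forall x, exists i, x \in tnth pi i].

End OrderedPartitions.

Section InducedPartitions.
Variables (n : nat) (Q : typed_quiver n).

Definition oriented_polygon m (s : m.-tuple Q) : Prop :=
  exists I : m.-tuple {set 'I_n.+1}, ordered_partition I /\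
    forall i j : 'I_m, j = i.+1 :> nat ->
      moved (tnth I i) (tnth s i) (tnth s j).

(* R_v^D \cap H *)
Definition region (H D : {fset Q}) (v : Q) : {set H} :=
  finset (fun u : H => `[< is_shadow D (val u) v >]).

(* pi is the ordered partition of H induced by D and v; s is the ordering of D
   starting at v, which is unique. *)
Definition induced_partition (H D : {fset Q}) (v : Q) m
    (pi : m.-tuple {set H}) : Prop :=
  exists s : m.-tuple Q,
    [/\ uniq s, s =i D, ohead s = Some v, oriented_polygon s
      & pi = map_tuple (region H D) s].

End InducedPartitions.

Section Polytopes.
Variables (R : realType) (E : finType).
Implicit Types (mu : {set E} -> R) (q : {ffun E -> R}) (I : {set E}).
Local Open Scope ring_scope.

Definition mu_star mu I : R := mu [set: E]%SET - mu (~: I)%SET.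

Definition polytope mu : set {ffun E -> R} :=
  fun q => forall I, mu I <= \sum_(v in I) q v <= mu_star mu I.

Definition flag (s : seq {set E}) (j : nat) : {set E} :=
  (\bigcup_(A <- take j s) A)%SET.

Definition splitting mu (s : seq {set E}) : {set E} -> R := fun I =>
  \sum_(j < size s)
    (mu ((I :&: flag s j.+1) :|: flag s j)%SET - mu (flag s j)).

Definition affine_hull (S : set {ffun E -> R}) : set {ffun E -> R} :=
  fun p => exists (k : nat) (c : 'I_k -> R) (x : 'I_k -> {ffun E -> R}),
    [/\ forall i, S (x i), \sum_i c i = 1
      & forall v, p v = \sum_i c i * x i v].

(* Interior relative to the affine hull, with balls of the sup norm. *)
Definition relative_interior (S : set {ffun E -> R}) : set {ffun E -> R} :=
  fun q => S q /\ exists2 e : R, 0 < e &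
    forall p, affine_hull S p -> (forall v, `|p v - q v| < e) -> S p.

Definition Omega (d : nat) : set {ffun E -> R} :=
  fun q => (forall v, 0 <= q v) /\ \sum_v q v = d%:R.

End Polytopes.

Arguments Omega : clear implicits.

(* The external direct sum of a finite family of vector spaces. *)
Section DirectSum.
Import VectorInternalTheory.
Variables (K : fieldType) (I : finType) (V : I -> vectType K).
Local Open Scope ring_scope.

Definition dsum := {dffun forall i : I, V i}.
HB.instance Definition _ := Choice.on dsum.
Implicit Types x y z : dsum.

Definition dsum_proj i x : V i := (x : {dffun forall i : I, V i}) i.

Definition dsum_of (f : forall i, V i) : dsum := [ffun i => f i].

Lemma dsum_ofE f i : dsum_proj i (dsum_of f) = f i.
Proof. exact: ffunE. Qed.

Lemma dsumP x y : (forall i, dsum_proj i x = dsum_proj i y) <-> x = y.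
Proof. exact: ffunP. Qed.

Let add x y := dsum_of (fun i => dsum_proj i x + dsum_proj i y).
Let opp x := dsum_of (fun i => - dsum_proj i x).
Let zero := dsum_of (fun i => 0).
Let scale (a : K) x := dsum_of (fun i => a *: dsum_proj i x).

Fact dsum_addA : associative add.
Proof. by move=> x y z; apply/dsumP=> i; rewrite !dsum_ofE addrA. Qed.
Fact dsum_addC : commutative add.
Proof. by move=> x y; apply/dsumP=> i; rewrite !dsum_ofE addrC. Qed.
Fact dsum_add0 : left_id zero add.
Proof. by move=> x; apply/dsumP=> i; rewrite !dsum_ofE add0r. Qed.
Fact dsum_addN : left_inverse zero opp add.
Proof. by move=> x; apply/dsumP=> i; rewrite !dsum_ofE addNr. Qed.
HB.instance Definition _ :=
  GRing.isZmodule.Build dsum dsum_addA dsum_addC dsum_add0 dsum_addN.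

Fact dsum_scaleA a b x : scale a (scale b x) = scale (a * b) x.
Proof. by apply/dsumP=> i; rewrite !dsum_ofE scalerA. Qed.
Fact dsum_scale1 : left_id 1 scale.
Proof. by move=> x; apply/dsumP=> i; rewrite !dsum_ofE scale1r. Qed.
Fact dsum_scaleDr : right_distributive scale +%R.
Proof. by move=> a x y; apply/dsumP=> i; rewrite !dsum_ofE scalerDr. Qed.
Fact dsum_scaleDl x : {morph scale^~ x : a b / a + b}.
Proof. by move=> a b; apply/dsumP=> i; rewrite !dsum_ofE scalerDl. Qed.
HB.instance Definition _ :=
  GRing.Zmodule_isLmodule.Build K dsum
    dsum_scaleA dsum_scale1 dsum_scaleDr dsum_scaleDl.

Fact dsum_proj_linear i : linear (dsum_proj i).
Proof. by move=> a x y; rewrite [LHS]dsum_ofE [X in X + _]dsum_ofE. Qed.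
HB.instance Definition _ i :=
  GRing.isLinear.Build K dsum (V i) _ (dsum_proj i) (dsum_proj_linear i).

Fact dsum_vect_iso : Vector.axiom #|{: {i : I & 'I_(dim (V i))}}| dsum.
Proof.
pose T := {i : I & 'I_(dim (V i))}.
pose fr x := \row_(k < #|{: T}|)
  v2r (dsum_proj (tag (enum_val k)) x) ord0 (tagged (enum_val k)).
exists fr.
  by move=> a x y; apply/rowP=> k; rewrite !mxE !linearP !mxE.
exists (fun r : 'rV_#|{: T}| => dsum_of (fun i =>
  r2v (\row_(j < dim (V i)) r ord0 (enum_rank (Tagged _ j : T))))).
  move=> x; apply/dsumP=> i; rewrite dsum_ofE; apply: (canLR v2rK).
  by apply/rowP=> j; rewrite !mxE enum_rankK.
move=> r; apply/rowP=> k; rewrite !mxE dsum_ofE r2vK mxE.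
by congr (r _ _); rewrite -[RHS]enum_valK; congr enum_rank; case: (enum_val k).
Qed.
HB.instance Definition _ := Lmodule_hasFinDim.Build K dsum dsum_vect_iso.

(* The sum of the V i for i in A, as the space of elements supported on A. *)
Definition dsum_on (A : {set I}) : {vspace dsum} :=
  (\bigcap_(i | i \notin A) lker (linfun (dsum_proj i)))%VS.

Lemma mem_dsum_on (A : {set I}) x :
  reflect (forall i, i \notin A -> dsum_proj i x = 0) (x \in dsum_on A).
Proof.
rewrite /dsum_on memvE; apply: (iffP subv_bigcapP) => xA i iA;
  by move: (xA i iA); rewrite -memvE memv_ker lfunE => /eqP.
Qed.

Definition mu_of (R : realType) (W : {vspace dsum}) (A : {set I}) : R :=
  (\dim (W :&: dsum_on A))%:R.

End DirectSum.

Record representation (K : fieldType) (n : nat) (Q : typed_quiver n) :=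
  Representation {
    rspace :> Q -> vectType K;
    rmap : forall u v : Q, arrow u v -> 'Hom(rspace u, rspace v)
  }.

Section LinkedNets.
Variables (K : fieldType) (n : nat) (Q : typed_quiver n).
Variable V : representation K Q.
Implicit Types u v w : Q.
Local Open Scope ring_scope.

Fixpoint path_map u v (p : qpath u v) : 'Hom(V u, V v) :=
  match p with
  | qnil _ => \1%VF
  | qcons _ _ _ a p' => (path_map p' \o rmap V a)%VF
  end.

Definition linked_net : Prop :=
  [/\ forall u v (p q : qpath u v), admissible q ->
        exists c : K, path_map p = c *: path_map q,
      forall u v (p : qpath u v), minimal_circuit p -> path_map p = 0
    & forall u v w (p : qpath u v) (q : qpath u w),
        admissible p -> admissible q -> [disjoint Ess p & Ess q] ->
        (lker (path_map p) :&: lker (path_map q))%VS = 0%VS].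

(* phi^u_w is determined only up to a nonzero scalar, which does not affect its
   image and kernel: hence the quantification over all admissible paths. *)
Definition exact_net : Prop :=
  forall u w, neighbors u w ->
  forall (p : qpath u w) (q : qpath w u), admissible p -> admissible q ->
  limg (path_map p) = lker (path_map q).

Definition nontrivial_net : Prop := forall v, fullv != 0%VS :> {vspace V v}.

Definition of_dimension (d : nat) : Prop := forall v, \dim {:V v} = d.

Definition one_generated (S : set Q) : Prop :=
  forall v, exists w, S w /\ exists p : qpath w v, limg (path_map p) = fullv.

Definition finitely_generated : Prop :=
  exists H : {fset Q}, forall v,
  exists (k : nat) (w : 'I_k -> Q) (p : forall i, qpath (w i) v),
    (forall i, w i \in H) /\ (\sum_i limg (path_map (p i)))%VS = fullv.

Definition min_generators : set Q :=
  fun v => forall S : set Q, one_generated S -> S v.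

End LinkedNets.

Section NetPolytopes.
Variables (R : realType) (K : fieldType) (n : nat) (Q : typed_quiver n).
Variables (V : representation K Q) (H : {fset Q}).
(* The chosen paths gam v u; only those with v and u in H matter. *)
Variable gam : forall v u : Q, qpath v u.
Local Open Scope ring_scope.

Definition common_ker (v : Q) (A : {set H}) : {vspace V v} :=
  (\bigcap_(u in A) lker (path_map V (gam v (val u))))%VS.

Definition mu_vertex (v : Q) (I : {set H}) : R :=
  (\dim (common_ker v (~: I)%SET))%:R.

Section PolygonSpace.
Variable D : {fset Q}.

Definition shadow (u : Q) : option D :=
  [pick w : D | `[< is_shadow D u (val w) >]].

Definition VDelta : vectType K :=
  dsum (fun v : D => subvs_of (common_ker (val v) (~: region H D (val v))%SET)).

(* Every vertex has a shadow in a polygon, so the None branch is never used. *)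
Definition VDelta_map (s : VDelta) : dsum (fun u : H => V (val u)) :=
  dsum_of (fun u : H =>
    if shadow (val u) is Some w
    then path_map V (gam (val w) (val u)) (vsval (dsum_proj w s))
    else 0).

Fact VDelta_map_linear : linear VDelta_map.
Proof.
move=> a s t; apply/dsumP=> u; rewrite linearP /= !dsum_ofE.
case: (shadow _) => [w|]; last by rewrite scaler0 addr0.
by rewrite !linearP.
Qed.
HB.instance Definition _ :=
  GRing.isLinear.Build K VDelta _ _ VDelta_map VDelta_map_linear.

Definition WDelta : {vspace dsum (fun u : H => V (val u))} :=
  limg (linfun VDelta_map).

Definition mu_polygon : {set H} -> R := mu_of R WDelta.

End PolygonSpace.

End NetPolytopes.

(* Main.v *)
From HB Require Import structures.
From mathcomp Require Import all_boot all_order all_algebra.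
From mathcomp Require Import finmap.
From mathcomp Require Import boolp classical_sets reals.
From mathcomp Require Import zify finset.
Require Import Defs.

Set Implicit Arguments.
Unset Strict Implicit.
Unset Printing Implicit Defensive.

Import Order.TTheory GRing.Theory Num.Theory.

(** Every kernel that matters is indexed by a set of arrow types. For a set [J]
    of arrow types let [N J] be the kernel of the map along a path leaving [v]
    with one arrow of each type in [J]. Kernels along admissible paths without a
    common arrow type meet trivially, so [N] turns intersections of sets into
    intersections of subspaces ([set_kerI]); together with exactness this shows
    that the kernel along an admissible path [p] from [v] is [N (Ess p)]
    ([ker_set_ker]). Writing [E u] for the essential type of an admissible path
    from [v] to [u], the value of [mu_vertex] at [I] is therefore the dimension
    of [N J], where [J] is the intersection of the [E u] for [u] outside [I].

    Let [q] be a point of the polytope of the splitting with positive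
    coordinates, let [F_k] be the union of the first [k] blocks and [J_k] the
    intersection of the [E u] for [u] outside [F_k]; thus [J_0] is empty and
    [J_m] contains every type. As [q] and [mu_vertex] agree on the flag
    ([polytope_splitting_flag]) and [q] is positive, removing one vertex [u]
    from [F_k] makes [mu_vertex] drop, so that [N J_k] is not contained in
    [N (E u)] for [u] in [F_k] ([flag_ker_not_sub]). Hence the [J_k] increase
    strictly, and the vertices [x_k = J_k . v], for [k < m], form an oriented
    polygon. A vertex [u] of the [k]-th block, counting from 0, satisfies
    [J_k <= E u] but not [J_k.+1 <= E u]: some type in [J_k.+1] is then avoided
    by paths from any vertex of the polygon through [x_k] to [u], so [x_k] is the
    shadow of [u] ([part_shadow]).

    The [x_k] are generators. Finite generation bounds the length of a path
    into a given vertex whose map is surjective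
    ([surjective_path_bounded]), so every vertex receives a surjective map from
    a minimal generator; a vertex with a nonzero map to each generator must then
    be one itself ([min_generators_nonzero]), and the maps from [x_k] to the
    generators are nonzero, again because [N J_k] is not contained in [N (E u)].

    Finally, the map from [v] to [x_k] has kernel [N J_k], and its image is the
    intersection of the kernels of the maps from [x_k] to the generators in
    [F_k]. Counting dimensions gives each term of the splitting as a value of
    [mu_vertex] at [x_k] ([dim_common_ker_part]), and [mu_polygon] is the sum of
    these values ([mu_polygonE]). *)

(** * Paths in a quiver of Z^n type *)

Section QuiverPaths.
Variables (n : nat) (Q : typed_quiver n).
Implicit Types (u v w x z : Q) (t : 'I_n.+1).

Lemma ptype_cat u v w (p : qpath u v) (q : qpath v w) t :
  ptype (qcat p q) t = ptype p t + ptype q t.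
Proof. by elim: p q => [//|{}u {}v x a p IH] q /=; rewrite IH addnA. Qed.

(** Elimination of a path without arrows: it is trivial, including in properties
    that depend on its target. *)
Lemma ptype0_nil u v (p : qpath u v) (P : forall w, qpath u w -> Prop) :
  (forall t, ptype p t = 0) -> P u (qnil u) -> P v p.
Proof.
by case: p P => [//|{}u {}v x a p] P /(_ (atype a)) /=; rewrite eqxx.
Qed.

Lemma admissibleP u v (p : qpath u v) :
  reflect (exists t, ptype p t = 0) (admissible p).
Proof. by apply: (iffP existsP) => -[t /eqP]; exists t => //; apply/eqP. Qed.

Lemma mem_Ess u v (p : qpath u v) t : (t \in Ess p) = (0 < ptype p t).
Proof. by rewrite inE. Qed.

Lemma admissible_Ess u v (p : qpath u v) : admissible p = (Ess p != setT).
Proof.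
apply/admissibleP/idP => [[t p0]|/eqP NE].
  by apply/eqP=> E; move: (in_setT t); rewrite -E mem_Ess p0.
apply: contra_notP NE => Np; apply/setP=> t; rewrite mem_Ess in_setT lt0n.
by apply/eqP=> p0; apply: Np; exists t.
Qed.

(** The hypothesis [ptype p t = (t \in J)] says that [p] has one arrow of each
    type in [J] and no other: [p] is simple of essential type [J]. *)
Lemma Ess_of_set u v (p : qpath u v) (J : {set 'I_n.+1}) :
  (forall t, ptype p t = (t \in J)) -> Ess p = J.
Proof. by move=> pJ; apply/setP=> t; rewrite mem_Ess pJ lt0b. Qed.

Lemma simple_of_set u v (p : qpath u v) (J : {set 'I_n.+1}) :
  (forall t, ptype p t = (t \in J)) -> simple_path p.
Proof. by move=> pJ; apply/forallP=> t; rewrite pJ leq_b1. Qed.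

Hypothesis quiverQ : Zn_quiver Q.

Lemma exists_path u (f : 'I_n.+1 -> nat) :
  exists w (p : qpath u w), forall t, ptype p t = f t.
Proof.
have [_ out _ _] := quiverQ.
have [k] := ubnP (\sum_t f t).
elim: k => [//|k IH] in u f *; rewrite ltnS => le_k.
have [/existsP[t0 ft0]|/existsPn f0] := boolP [exists t, 0 < f t];
  last first.
  by exists u, (qnil u) => t /=; apply/esym/eqP; rewrite -leqn0 leqNgt.
have [[x a] /= [ta _]] := out u t0.
have [|w [p pE]] := IH x (fun t => f t - (t0 == t)).
  apply: leq_trans le_k; rewrite (bigD1 t0) // [X in _ < X](bigD1 t0) //= eqxx.
  rewrite -addSn leq_add //; first by rewrite subn1 prednK.
  by apply: leq_sum => t _; apply: leq_subr.
exists w, (qcons a p) => t /=; rewrite pE ta.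
by case: eqP => [<-|_]; rewrite ?subn0 ?add0n // addnC subnK.
Qed.

Lemma path_end u v w (p : qpath u v) (q : qpath u w) c :
  (forall t, ptype p t = ptype q t + c) -> v = w.
Proof.
have [_ _ _ endP] := quiverQ; move=> E; apply/(endP u v w p q).
by exists (Posz c) => t; rewrite E; lia.
Qed.

Lemma ptype_excess u v (p q : qpath u v) :
  admissible q -> exists c, forall t, ptype p t = ptype q t + c.
Proof.
have [_ _ _ endP] := quiverQ; move=> /admissibleP[t0 q0].
have /(endP u v v p q)[c E] := erefl v.
by exists (ptype p t0) => t; have := E t; have := E t0; lia.
Qed.

Lemma ptype_unique u v (p q : qpath u v) :
  admissible p -> admissible q -> ptype p =1 ptype q.
Proof.
move=> /admissibleP[t0 p0] /(ptype_excess p)[c E] t.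
by have := E t0; have := E t; lia.
Qed.

Lemma ptype_loop u v (p : qpath u v) t : u = v -> admissible p -> ptype p t = 0.
Proof.
move=> euv; case: _ / euv p => p ap.
have au : admissible (qnil u) by apply/admissibleP; exists ord0.
by rewrite (ptype_unique ap au).
Qed.

Lemma exists_admissible u v : exists p : qpath u v, admissible p.
Proof.
have [_ _ conn _] := quiverQ.
have [->|/conn //] := eqVneq u v.
by exists (qnil v); apply/admissibleP; exists ord0.
Qed.

(** A path with a prescribed type reaches a prescribed vertex as soon as the
    types match modulo constants. *)
Lemma path_between u z x (p : qpath u z) (q : qpath u x)
    (f : 'I_n.+1 -> nat) c :
  (forall t, ptype p t + f t = ptype q t + c) ->
  exists g : qpath z x, forall t, ptype g t = f t.
Proof.
move=> E; have [w [g gE]] := exists_path z f.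
have /path_end ewx : forall t, ptype (qcat p g) t = ptype q t + c.
  by move=> t; rewrite ptype_cat gE E.
by case: _ / ewx in q E *; exists g.
Qed.

Definition set_path_sig u (J : {set 'I_n.+1}) :
  {b : {w : Q & qpath u w} | forall t, ptype (projT2 b) t = (t \in J)}.
Proof.
by apply: cid; have [w [p pE]] := exists_path u (fun t => t \in J);
  exists (existT _ w p).
Qed.

(** [set_end u J] is the vertex J.u, and [set_path u J] a chosen path from [u]
    to it with one arrow of each type in [J]. When [J] consists of all arrow
    types this path is a minimal circuit. *)
Definition set_end u J : Q := projT1 (sval (set_path_sig u J)).
Definition set_path u J : qpath u (set_end u J) :=
  projT2 (sval (set_path_sig u J)).

Lemma ptype_set_path u J t : ptype (set_path u J) t = (t \in J).
Proof. exact: (svalP (set_path_sig u J)). Qed.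

Lemma Ess_set_path u J : Ess (set_path u J) = J.
Proof. by apply: Ess_of_set => t; apply: ptype_set_path. Qed.

Lemma admissible_set_path u J : admissible (set_path u J) = (J != setT).
Proof. by rewrite admissible_Ess Ess_set_path. Qed.

End QuiverPaths.

(** * Maps along paths in a linked net *)

Section NetKernels.
Variables (K : fieldType) (n : nat) (Q : typed_quiver n).
Variable V : representation K Q.
Implicit Types (u v w x z : Q) (t : 'I_n.+1).
Local Open Scope ring_scope.

Lemma path_map_cat u v w (p : qpath u v) (q : qpath v w) :
  path_map V (qcat p q) = (path_map V q \o path_map V p)%VF.
Proof.
elim: p q => [{}u q|{}u {}v x a p IH q] /=; first by rewrite comp_lfun1r.
by rewrite IH comp_lfunA.
Qed.

Lemma map_ptype0 u v (p : qpath u v) : (forall t, ptype p t = 0)%N ->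
  lker (path_map V p) = 0%VS /\ limg (path_map V p) = fullv.
Proof.
move=> p0.
apply: (ptype0_nil (P := fun w p => lker (path_map V p) = 0%VS /\
  limg (path_map V p) = fullv) p0) => /=.
split; last by rewrite lim1g.
by apply/eqP; rewrite -subv0; apply/subvP=> s; rewrite memv_ker id_lfunE memv0.
Qed.

Lemma mem_lker_cat u v w (p : qpath u v) (q : qpath v w) s :
  (s \in lker (path_map V (qcat p q))) =
  (path_map V p s \in lker (path_map V q)).
Proof. by rewrite !memv_ker path_map_cat comp_lfunE. Qed.

Hypotheses (quiverQ : Zn_quiver Q) (netV : linked_net V).

Lemma adm_scale u v (p q : qpath u v) : admissible p -> admissible q ->
  exists2 c : K, c != 0 & path_map V p = c *: path_map V q.
Proof.
have [scal _ _] := netV; move=> ap aq.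
have [c Ec] := scal _ _ p q aq; have [d Ed] := scal _ _ q p ap.
have [c0|cn] := eqVneq c 0; last by exists c.
exists 1; first exact: oner_neq0.
by rewrite Ed Ec c0 scale0r scaler0 scale1r.
Qed.

Lemma ker_adm u v (p q : qpath u v) : admissible p -> admissible q ->
  lker (path_map V p) = lker (path_map V q).
Proof.
move=> ap aq; have [c cn E] := adm_scale ap aq; apply/vspaceP=> s.
by rewrite !memv_ker E scale_lfunE scaler_eq0 (negPf cn).
Qed.

(** The maps along two non-admissible paths with the same ends need not be
    proportional a priori, so an admissible prefix is reordered instead, until a
    minimal circuit appears. *)
Lemma nonadm_map0 u v (p : qpath u v) : ~~ admissible p -> path_map V p = 0.
Proof.
have [_ circ _] := netV.
(* The path is split after its longest admissible prefix. *)
suff key : forall x (a : qpath x u), admissible a ->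
    ~~ admissible (qcat a p) -> path_map V (qcat a p) = 0.
  by apply: (key u (qnil u)); apply/admissibleP; exists ord0.
elim: p => {u v} [u x a aa|u y v e p IH x a aa].
  case/negP; case/admissibleP: aa => t at0; apply/admissibleP; exists t.
  by rewrite ptype_cat at0.
have -> : qcat a (qcons e p) = qcat (qcat a (qcons e (qnil y))) p.
  by elim: {aa} a e => [//|x' y' z' e' a IHa] e /=; rewrite IHa.
set b := qcat a _; have [ab|Nab _] := boolP (admissible b); first exact: IH.
suff b0 : path_map V b = 0 by rewrite path_map_cat b0 comp_lfun0r.
(* The prefix a misses only the type of e, hence its map is proportional to
   that of a path ending with one arrow of each other type. *)
have pb t : ptype b t = (ptype a t + (atype e == t))%N.
  by rewrite ptype_cat /= addn0.
have b_gt0 t : (0 < ptype b t)%N.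
  by rewrite lt0n; apply: contra Nab => /eqP bt; apply/admissibleP; exists t.
have [t0 at0] := admissibleP _ aa.
have et0 : atype e = t0.
  by apply/eqP; have := b_gt0 t0; rewrite pb at0; case: eqP.
have [w [a1 a1E]] :=
  exists_path quiverQ x (fun t => ptype a t - (t != t0))%N.
have [|a2 a2E] := path_between quiverQ (p := a1) (q := a)
    (f := fun t => t != t0) (c := 0%N).
  move=> t; rewrite a1E addn0; have := b_gt0 t; rewrite pb et0 eq_sym.
  by case: eqVneq => _ /=; lia.
have aa12 : admissible (qcat a1 a2).
  by apply/admissibleP; exists t0; rewrite ptype_cat a1E a2E eqxx at0.
have [c _ E] := adm_scale aa aa12.
have c0 : path_map V (qcat a2 (qcons e (qnil y))) = 0.
  apply: circ; apply/andP; split.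
    apply/forallP=> t; rewrite ptype_cat a2E /= et0 (eq_sym t0).
    by case: eqVneq.
  apply/admissibleP=> -[t]; rewrite ptype_cat a2E /= et0 (eq_sym t0).
  by case: eqVneq.
rewrite /b path_map_cat E path_map_cat -comp_lfunZr comp_lfunA.
by rewrite -(path_map_cat a2) c0 comp_lfun0l scaler0.
Qed.

End NetKernels.

(** * Kernels depend only on essential types *)

Section SetKernels.
Variables (K : fieldType) (n : nat) (Q : typed_quiver n).
Variable V : representation K Q.
Hypotheses (quiverQ : Zn_quiver Q) (netV : linked_net V) (exactV : exact_net V).
Implicit Types (u v w x z : Q) (t : 'I_n.+1) (I J : {set 'I_n.+1}).
Local Open Scope ring_scope.

Lemma limg_lker_exact u v (p : qpath u v) (q : qpath v u) :
  u != v -> simple_path p -> admissible p -> admissible q ->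
  limg (path_map V p) = lker (path_map V q).
Proof. by move=> uv sp; apply: exactV; split=> //; exists p. Qed.

(** By exactness the image along [p] is the kernel along a path of the
    complementary type, which meets kernels along paths of types in [Ess p]
    trivially. *)
Lemma img_cap_ker0 u v w (p : qpath u v) (q : qpath v w) :
  simple_path p -> admissible p -> admissible q -> Ess q \subset Ess p ->
  (limg (path_map V p) :&: lker (path_map V q))%VS = 0%VS.
Proof.
have [_ _ disj] := netV; move=> sp ap aq sub.
have [E0|/set0Pn[t0]] := eqVneq (Ess p) set0.
  rewrite E0 subset0 in sub.
  have [|-> _] := @map_ptype0 _ _ _ V _ _ q; last exact: capv0.
  by move=> t; apply/eqP; rewrite -leqn0 leqNgt -mem_Ess (eqP sub) inE.
rewrite mem_Ess => pt0.
have uv : u != v.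
  by apply/eqP=> euv; rewrite (ptype_loop quiverQ t0 euv ap) in pt0.
have [|g gE] := path_between quiverQ (p := p) (q := qnil u)
    (f := fun t => t \notin Ess p) (c := 1%N).
  move=> t; rewrite mem_Ess /=; have /forallP/(_ t) := sp.
  by case: (ptype p t) => [|[|]].
have eg : Ess g = (~: Ess p)%SET by apply: Ess_of_set => t; rewrite gE in_setC.
have ag : admissible g.
  by apply/admissibleP; exists t0; rewrite gE mem_Ess pt0.
rewrite (limg_lker_exact uv sp ap ag); apply: disj => //.
by rewrite eg disjoints_subset setCS.
Qed.

(** The kernel of the map along a path of type [J] leaving [u]; this is the
    whole space when [J] consists of all arrow types. *)
Definition set_ker u J : {vspace V u} :=
  lker (path_map V (set_path quiverQ u J)).

Lemma set_kerT u : set_ker u setT = fullv.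
Proof.
apply/vspaceP=> s; rewrite memvf memv_ker (nonadm_map0 quiverQ netV) //.
  by rewrite lfunE eqxx.
by rewrite admissible_set_path eqxx.
Qed.

Lemma set_ker0 u : set_ker u set0 = 0%VS.
Proof.
by apply: (proj1 (map_ptype0 V _)) => t; rewrite ptype_set_path inE.
Qed.

Lemma path_map_setD u I J : I \subset J -> J != setT ->
  exists2 g : qpath (set_end quiverQ u I) (set_end quiverQ u J),
    Ess g = J :\: I &
    set_ker u J = lker (path_map V (qcat (set_path quiverQ u I) g)).
Proof.
move=> IJ JT; set p := set_path _ _ _.
have [|g gE] := path_between quiverQ (p := p) (q := set_path quiverQ u J)
    (f := fun t => t \in J :\: I) (c := 0).
  move=> t; rewrite !ptype_set_path inE addn0.
  by case: (boolP (t \in I)) => // /(fintype.subsetP IJ) ->.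
exists g; first exact: Ess_of_set.
apply: ker_adm => //; first by rewrite admissible_set_path.
rewrite admissible_Ess; apply: contraNneq JT => <-; apply/eqP/setP=> t.
rewrite mem_Ess ptype_cat ptype_set_path gE inE.
by case: (boolP (t \in I)) => [/(fintype.subsetP IJ) ->|_]; rewrite ?lt0b.
Qed.

Lemma set_kerS u I J : I \subset J -> (set_ker u I <= set_ker u J)%VS.
Proof.
move=> IJ; have [->|JT] := eqVneq J setT; first by rewrite set_kerT subvf.
have [g _ ->] := path_map_setD u IJ JT.
apply/subvP=> s; rewrite mem_lker_cat memv_ker => /eqP ->.
exact: mem0v.
Qed.

Lemma set_kerI u I J : set_ker u (I :&: J) = (set_ker u I :&: set_ker u J)%VS.
Proof.
have [_ _ disj] := netV.
have [->|IT] := eqVneq I setT; first by rewrite set_kerT setTI capfv.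
have [->|JT] := eqVneq J setT; first by rewrite set_kerT setIT capvf.
apply: subv_anti; rewrite subv_cap !set_kerS ?subsetIl ?subsetIr //=.
have [g Eg ->] := path_map_setD u (subsetIl I J) IT.
have [h Eh ->] := path_map_setD u (subsetIr I J) JT.
have proper_setD : forall A B : {set 'I_n.+1}, A != setT -> A :\: B != setT.
  move=> A B; apply: contraNneq => AB; apply/eqP/setP=> t.
  by have := in_setT t; rewrite -{1}AB !inE => /andP[].
have gh0 : (lker (path_map V g) :&: lker (path_map V h) = 0)%VS.
  have ag : admissible g by rewrite admissible_Ess Eg proper_setD.
  have ah : admissible h by rewrite admissible_Ess Eh proper_setD.
  apply: disj ag ah _; rewrite Eg Eh.
  by rewrite -setI_eq0; apply/eqP/setP=> t; rewrite !inE; do 2!case: (_ \in _).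
apply/subvP=> s /memv_capP[]; rewrite 2!mem_lker_cat => sg sh.
rewrite memv_ker -memv0 -gh0; exact/memv_capP.
Qed.

(** In an exact linked net the kernel along an admissible path only depends on
    the source and on the essential type of the path. *)
Lemma ker_set_ker u v (p : qpath u v) : admissible p ->
  lker (path_map V p) = set_ker u (Ess p).
Proof.
move=> ap; set q := set_path quiverQ u (Ess p).
have [|g gE] := path_between quiverQ (p := q) (q := p)
    (f := fun t => (ptype p t - (t \in Ess p))%N) (c := 0).
  by move=> t; rewrite ptype_set_path addn0 mem_Ess; case: (ptype p t); lia.
have Eq : Ess q = Ess p by apply: Ess_set_path.
have gp : Ess g \subset Ess q.
  apply/fintype.subsetP=> t; rewrite Eq !mem_Ess gE; case: (ptype p t) => //.
have aqg : admissible (qcat q g).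
  have /admissibleP[t pt] := ap; apply/admissibleP; exists t.
  by rewrite ptype_cat gE ptype_set_path mem_Ess pt.
have aq : admissible q by rewrite admissible_Ess Eq -admissible_Ess.
have ag : admissible g.
  by have /admissibleP[t pt] := ap; apply/admissibleP; exists t; rewrite gE pt.
rewrite (ker_adm netV ap aqg); apply/vspaceP=> s; rewrite mem_lker_cat.
rewrite [in RHS]memv_ker; apply/idP/eqP => [sg|->]; last exact: mem0v.
apply/eqP; rewrite -memv0 -(img_cap_ker0 _ aq ag gp); last first.
  by apply: (@simple_of_set _ _ _ _ _ (Ess p)) => t; apply: ptype_set_path.
by rewrite memv_cap sg memv_img ?memvf.
Qed.

End SetKernels.

(** * The minimum set of generators *)

Section Generators.
Variables (K : fieldType) (n : nat) (Q : typed_quiver n).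
Variable V : representation K Q.
Hypotheses (quiverQ : Zn_quiver Q) (netV : linked_net V).
Hypotheses (nontrivV : nontrivial_net V) (fingenV : finitely_generated V).
Implicit Types (u v w x z : Q) (t : 'I_n.+1).
Local Open Scope ring_scope.

(** The number of arrows of a path. *)
Definition path_length u v (p : qpath u v) : nat := (\sum_t ptype p t)%N.

Lemma path_length_cat u v w (p : qpath u v) (q : qpath v w) :
  path_length (qcat p q) = (path_length p + path_length q)%N.
Proof. by rewrite -big_split; apply: eq_bigr => t _; apply: ptype_cat. Qed.

Lemma path_length_gt0 u v (p : qpath u v) : u != v -> (0 < path_length p)%N.
Proof.
apply: contraNT; rewrite -leqNgt leqn0 sum_nat_eq0 => /forallP p0.
apply/eqP; apply: (ptype0_nil (P := fun w _ => u = w) (p := p)) => // t.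
exact/eqP/(implyP (p0 t)).
Qed.

Lemma limg_cat_full u v w (p : qpath u v) (q : qpath v w) :
  limg (path_map V p) = fullv -> limg (path_map V q) = fullv ->
  limg (path_map V (qcat p q)) = fullv.
Proof. by move=> pf qf; rewrite path_map_cat limg_comp pf. Qed.

Lemma cat_map0 u v w (p : qpath u v) (q : qpath v w) :
  ~~ admissible (qcat p q) -> (limg (path_map V p) <= lker (path_map V q))%VS.
Proof.
move=> /(nonadm_map0 quiverQ netV) pq0; apply/subvP=> _ /memv_imgP[s _ ->].
by rewrite -mem_lker_cat memv_ker pq0 lfunE.
Qed.

Lemma surjective_not0 u v (p : qpath u v) :
  limg (path_map V p) = fullv -> ~~ (fullv <= lker (path_map V p))%VS.
Proof. by move=> pf; rewrite lkerE pf nontrivV. Qed.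

(** A surjective map into [v] is nonzero on the image of some generator, so its
    path extends to an admissible path from a vertex of a fixed finite set. *)
Lemma surjective_path_bounded v : exists B, forall u (p : qpath u v),
  limg (path_map V p) = fullv -> (path_length p <= B)%N.
Proof.
have [H0 gen] := fingenV.
pose geo w := sval (cid (exists_admissible quiverQ w v)).
(* A crude bound on the maximum of the lengths over the finite set [H0]. *)
exists (\sum_(w : H0) path_length (geo (val w)))%N => u p pf.
have [k [w [g [wH sumg]]]] := gen u.
have [/existsP[i adm_i]|/existsPn nadm] :=
  boolP [exists i, admissible (qcat (g i) p)].
  have -> : path_length p = (path_length (qcat (g i) p) - path_length (g i))%N.
    by rewrite path_length_cat addKn.
  apply: leq_trans (leq_subr _ _) _.
  rewrite (bigD1 [` wH i]%fset) //=; apply: leq_trans (leq_addr _ _).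
  apply: leq_sum => t _.
  rewrite (ptype_unique quiverQ adm_i (q := geo (w i))) //.
  exact: (svalP (cid (exists_admissible quiverQ (w i) v))).
have := surjective_not0 pf; rewrite -sumg => /negP[].
by apply/subv_sumP=> i _; apply: cat_map0.
Qed.

Lemma min_generators_mem x :
  (forall y (p : qpath y x), limg (path_map V p) = fullv -> y = x) ->
  min_generators V x.
Proof. by move=> noarrow S gen; have [w [Sw [p /noarrow <-]]] := gen x. Qed.

(** A surjective map into [v] along a path of maximal length starts at a vertex
    that every 1-generating set contains. *)
Lemma min_generators_generate : one_generated V (min_generators V).
Proof.
move=> v; have [B bound] := surjective_path_bounded v.
suff climb : forall k u (p : qpath u v), (B - path_length p <= k)%N ->
    limg (path_map V p) = fullv ->
    exists w, min_generators V w /\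
      exists q : qpath w v, limg (path_map V q) = fullv.
  by apply: (climb B v (qnil v)); rewrite ?leq_subr //= lim1g.
elim=> [|k IH] u p le_k pf.
  exists u; split; last by exists p.
  apply: min_generators_mem => y q qf; apply/eqP; apply: contraT => yu.
  have := bound _ _ (limg_cat_full qf pf); rewrite path_length_cat.
  by have := path_length_gt0 q yu; lia.
have [[y [q [qf yu]]]|none] := pselect (exists y (q : qpath y u),
    limg (path_map V q) = fullv /\ y != u).
  apply: (IH y (qcat q p)); last exact: limg_cat_full.
  by rewrite path_length_cat; have := path_length_gt0 q yu; lia.
exists u; split; last by exists p.
apply: min_generators_mem => y q qf; apply/eqP; apply: contraT => yu.
by case: none; exists y, q.
Qed.

(** A vertex outside the minimum set of generators receives a surjective map
    from some generator, hence its own map to that generator vanishes. *)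
Lemma min_generators_nonzero x :
  (forall u (p : qpath x u), min_generators V u -> admissible p ->
     ~~ (fullv <= lker (path_map V p))%VS) ->
  min_generators V x.
Proof.
move=> nz; have [z [Hz [q qf]]] := min_generators_generate x.
have [<- //|zx] := eqVneq z x.
have [p ap] := exists_admissible quiverQ x z.
have /negP[] := nz z p Hz ap; rewrite -qf; apply: cat_map0.
apply/negP=> aqp; have := path_length_gt0 q zx.
rewrite lt0n => /eqP[]; apply: big1 => t _; apply/eqP.
have := ptype_loop quiverQ t erefl aqp; rewrite ptype_cat; lia.
Qed.

End Generators.

(** * Flags of ordered partitions *)

Section Flags.
Variable E : finType.
Implicit Types (s : seq {set E}) (x : E).

Lemma flag0 s : flag s 0 = set0.
Proof. by rewrite /flag take0 big_nil. Qed.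

Lemma flagS s j : flag s j.+1 = flag s j :|: nth set0 s j.
Proof.
have [js|sj] := ltnP j (size s).
  by rewrite /flag (take_nth set0 js) -cats1 big_cat big_seq1.
by rewrite nth_default // setU0 /flag !take_oversize // ltnW.
Qed.

Lemma flagP s j x :
  reflect (exists2 i, i < j & x \in nth set0 s i) (x \in flag s j).
Proof.
elim: j => [|j IH]; first by rewrite flag0 inE; constructor; case.
rewrite flagS inE; apply: (iffP orP) => [[/IH[i ij xi]|xj]|[i]].
- by exists i => //; apply: ltnW.
- by exists j.
rewrite ltnS leq_eqVlt => /predU1P[-> xj|ij xi]; first by right.
by left; apply/IH; exists i.
Qed.

Lemma flag_sub s i j : i <= j -> flag s i \subset flag s j.
Proof.
move=> ij; apply/fintype.subsetP=> x /flagP[k ki xk]; apply/flagP.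
by exists k => //; apply: leq_trans ij.
Qed.

Variables (m : nat) (pi : m.-tuple {set E}).
Hypothesis partpi : ordered_partition pi.

Lemma partition_flag_full : flag pi m = setT.
Proof.
have [_ _ cov] := partpi; apply/setP=> x; rewrite in_setT.
have [i xi] := cov x; apply/flagP; exists i => //.
by rewrite -tnth_nth.
Qed.

Lemma partition_nth_flag j k x (kj : k <= j) :
  x \in nth set0 pi j -> x \notin flag pi k.
Proof.
have [_ disj _] := partpi; move=> xj; apply/flagP=> -[i ik xi].
have [jm|mj] := ltnP j m; last by rewrite nth_default ?size_tuple ?inE in xj.
have im : i < m by apply: leq_ltn_trans jm; apply: ltnW; apply: leq_trans kj.
rewrite -(tnth_nth _ pi (Ordinal jm)) in xj.
rewrite -(tnth_nth _ pi (Ordinal im)) in xi.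
have /disj/disjoint_setI0/setP/(_ x) : Ordinal im != Ordinal jm.
  by rewrite -val_eqE /= neq_ltn (leq_trans ik kj).
by rewrite !inE xi xj.
Qed.

Lemma partition_nonempty (k : 'I_m) : exists x, x \in nth set0 pi k.
Proof. by have [ne _ _] := partpi; rewrite -tnth_nth; apply/set0Pn. Qed.

Lemma partition_mem x : exists k : 'I_m, x \in nth set0 pi k.
Proof. by have [_ _ /(_ x)[k xk]] := partpi; exists k; rewrite -tnth_nth. Qed.

End Flags.

(** * Polytopes of splittings *)

Section SplittingPolytope.
Variables (R : realType) (E : finType) (mu : {set E} -> R) (s : seq {set E}).
Local Open Scope ring_scope.
Hypotheses (mu0 : mu set0 = 0)
  (super : forall A B : {set E}, mu A + mu B <= mu (A :|: B) + mu (A :&: B))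
  (full : flag s (size s) = setT).

Lemma splitting_ge I : mu I <= splitting mu s I.
Proof.
pose u j := mu (I :&: flag s j).
have -> : mu I = \sum_(j < size s) (u j.+1 - u j).
  rewrite -(big_mkord xpredT (fun j => u j.+1 - u j)) telescope_sumr //.
  by rewrite /u full setIT flag0 setI0 mu0 subr0.
apply: ler_sum => j _; rewrite /u lerBlDr addrAC lerBrDr.
have := super (I :&: flag s j.+1) (flag s j).
by rewrite -setIA (setIidPr (flag_sub s (leqnSn j))).
Qed.

(** The terms of the splitting at the complement of [flag s k] vanish before [k]
    and telescope from [k] on. *)
Lemma splitting_setC_flag k : (k <= size s)%N ->
  splitting mu s (~: flag s k) = mu setT - mu (flag s k).
Proof.
move=> ks; pose u j := mu (flag s (maxn j k)).
transitivity (\sum_(j < size s) (u j.+1 - u j)); last first.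
  rewrite -(big_mkord xpredT (fun j => u j.+1 - u j)) telescope_sumr //.
  by rewrite /u (maxn_idPl ks) full max0n.
apply: eq_bigr => j _; rewrite /u; have [jk|kj] := ltnP j k.
  have -> : (~: flag s k :&: flag s j.+1 :|: flag s j)%SET = flag s j.
    suff -> : (~: flag s k :&: flag s j.+1)%SET = set0 by rewrite set0U.
    apply/eqP; rewrite setIC -setDE setD_eq0; exact: flag_sub.
  by rewrite (maxn_idPr jk) !subrr.
have -> : (~: flag s k :&: flag s j.+1 :|: flag s j)%SET = flag s j.+1.
  apply/setP=> x; rewrite !inE.
  have := fintype.subsetP (flag_sub s (leqnSn j)) x.
  have := fintype.subsetP (flag_sub s kj) x.
  case: (x \in flag s k); first by move=> /(_ isT) -> /(_ isT) ->.
  by move=> _; case: (x \in flag s j) => [/(_ isT) ->|_] //; rewrite orbF.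
by rewrite (maxn_idPl (leqW kj)).
Qed.

Variable q : {ffun E -> R}.
Hypothesis qP : polytope (splitting mu s) q.

Lemma polytope_splitting_ge I : mu I <= \sum_(v in I) q v.
Proof. by apply: le_trans (splitting_ge I) _; have /andP[] := qP I. Qed.

(** A point of the polytope of the splitting lies on the face of the polytope of
    [mu] where the inequalities of the flag are equalities. *)
Lemma polytope_splitting_flag k : (k <= size s)%N ->
  \sum_(v in flag s k) q v = mu (flag s k).
Proof.
move=> ks; apply: le_anti; rewrite polytope_splitting_ge andbT.
have /andP[_ le] := qP (flag s k); apply: le_trans le _.
have := @splitting_setC_flag 0 (leq0n _); rewrite flag0 setC0 mu0 subr0.
by rewrite /mu_star => ->; rewrite splitting_setC_flag // subKr.
Qed.

End SplittingPolytope.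

(** * The relative interior of the simplex *)

Section SimplexInterior.
Local Open Scope ring_scope.

(** From a point whose coordinate at [v] is zero, moving slightly away from the
    vertex of the simplex supported at [v] leaves the simplex, but not its
    affine hull. *)
Lemma relative_interior_Omega_gt0 (R : realType) (E : finType) d
    (q : {ffun E -> R}) v : (0 < d)%N ->
  relative_interior (Omega R E d) q -> 0 < q v.
Proof.
move=> d0 [[q0 qd] [e e0 ball]]; rewrite lt_neqAle q0 andbT eq_sym.
apply/eqP=> qv; pose y : {ffun E -> R} := [ffun w => d%:R * (w == v)%:R].
have dR : 0 < d%:R :> R by rewrite ltr0n.
have yO : Omega R E d y.
  split=> [w|]; first by rewrite ffunE mulr_ge0 ?ler0n.
  rewrite (bigD1 v) //= ffunE eqxx mulr1 big1 ?addr0 // => w /negPf wv.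
  by rewrite ffunE wv mulr0.
(* Two points of the simplex differ by at most [d] in each coordinate. *)
pose c : R := e / (2 * d%:R).
have c0 : 0 < c by rewrite divr_gt0 ?mulr_gt0.
pose p : {ffun E -> R} := [ffun w => (1 + c) * q w - c * y w].
have [|w|p0 _] := ball p.
- exists 2, (fun i : 'I_2 => if i == ord0 then 1 + c else - c).
  exists (fun i : 'I_2 => if i == ord0 then q else y); split.
  + by move=> i; case: ifP.
  + by rewrite !big_ord_recl big_ord0 /= addr0 addrK.
  by move=> w; rewrite !big_ord_recl big_ord0 /= addr0 ffunE mulNr.
- have -> : p w - q w = c * (q w - y w).
    by rewrite ffunE mulrDl mul1r mulrBr addrAC (addrAC (q w)) subrr add0r.
  have qw : q w <= d%:R.
    by rewrite -qd (bigD1 w) //= lerDl sumr_ge0.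
  have le_d : `|q w - y w| <= d%:R.
    rewrite ffunE; case: eqP => _; last by rewrite mulr0 subr0 ger0_norm.
    by rewrite mulr1 distrC ger0_norm ?subr_ge0 // gerBl.
  rewrite normrM gtr0_norm //; apply: le_lt_trans (ler_wpM2l (ltW c0) le_d) _.
  rewrite /c invfM mulrA mulfVK ?gt_eqF // ltr_pdivrMr //.
  by rewrite ltr_pMr // ltr1n.
have := p0 v; rewrite !ffunE qv eqxx mulr0 add0r mulr1 oppr_ge0 leNgt.
by rewrite mulr_gt0.
Qed.

End SimplexInterior.

(** * Polytopes of vertices and of polygons *)

Section VertexPolytope.
Variables (R : realType) (K : fieldType) (n : nat) (Q : typed_quiver n).
Variables (V : representation K Q) (H : {fset Q}).
Variable gam : forall v u : Q, qpath v u.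
Hypotheses (quiverQ : Zn_quiver Q) (netV : linked_net V) (exactV : exact_net V).
Hypothesis adm_gam : forall v u, v \in H -> u \in H -> admissible (gam v u).
Local Open Scope ring_scope.

Implicit Types (v : Q) (u : H) (A B I : {set H}).

(** The arrow types used on the way from [v] to every vertex of [A]. *)
Definition common_Ess v A : {set 'I_n.+1} :=
  (\bigcap_(u in A) Ess (gam v (val u)))%SET.

Lemma common_EssS v A B : A \subset B -> common_Ess v B \subset common_Ess v A.
Proof.
move=> AB; apply/fintype.subsetP=> t /bigcapP tB; apply/bigcapP=> u uA.
exact/tB/(fintype.subsetP AB).
Qed.

Lemma common_EssU v A B :
  common_Ess v (A :|: B) = common_Ess v A :&: common_Ess v B.
Proof.
apply/setP=> t; rewrite inE.
apply/bigcapP/andP => [tAB|[/bigcapP tA /bigcapP tB]].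
  by split; apply/bigcapP=> u uA; apply: tAB; rewrite inE uA ?orbT.
by move=> u; rewrite inE => /orP[/tA|/tB].
Qed.

Lemma common_Ess1 v u : common_Ess v [set u] = Ess (gam v (val u)).
Proof. exact: big_set1. Qed.

Lemma mem_common_ker v A s :
  reflect (forall u, u \in A -> s \in lker (path_map V (gam v (val u))))
          (s \in common_ker V gam v A).
Proof.
by rewrite memvE; apply: (iffP subv_bigcapP) => sA u uA; move: (sA u uA);
  rewrite memvE.
Qed.

Lemma common_kerE v A : v \in H ->
  common_ker V gam v A = set_ker V quiverQ v (common_Ess v A).
Proof.
move=> vH; rewrite /common_Ess.
rewrite (big_morph (set_ker V quiverQ v) (set_kerI quiverQ netV v)
  (set_kerT quiverQ netV v)).
by apply: eq_bigr => u _; apply: ker_set_ker => //; apply: adm_gam (valP u).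
Qed.

Lemma common_EssT v : v \in H -> common_Ess v setT = set0.
Proof.
move=> vH; apply/setP=> t; rewrite inE; apply/bigcapP => /(_ [` vH]%fset).
by rewrite inE mem_Ess (ptype_loop quiverQ t _ (adm_gam vH vH)) // => /(_ isT).
Qed.

Lemma common_ker_setT v : v \in H -> common_ker V gam v (setT : {set H}) = 0%VS.
Proof. by move=> vH; rewrite common_kerE // common_EssT // set_ker0. Qed.

Lemma mu_vertex0 v : v \in H -> mu_vertex R V gam v (set0 : {set H}) = 0.
Proof. by move=> vH; rewrite /mu_vertex setC0 common_ker_setT // dimv0. Qed.

Lemma mu_vertex_super v A B : v \in H ->
  mu_vertex R V gam v A + mu_vertex R V gam v B <=
  mu_vertex R V gam v (A :|: B) + mu_vertex R V gam v (A :&: B).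
Proof.
move=> vH; rewrite /mu_vertex -!natrD ler_nat !common_kerE //.
rewrite (setCI A B) common_EssU set_kerI // -dimv_sum_cap leq_add2r.
by apply: dimvS; rewrite subv_add !set_kerS // common_EssS // setCS
  ?subsetUl ?subsetUr.
Qed.

Section PolygonSpace.
Variable D : {fset Q}.

Lemma is_shadow_unique (x w w' : Q) :
  is_shadow D x w -> is_shadow D x w' -> w = w'.
Proof.
move=> [wD sw] [w'D sw'].
have [p [q apq]] := sw' w wD; have [p' [q' apq']] := sw w' w'D.
have aq : admissible q.
  by have /admissibleP[t] := apq; rewrite ptype_cat => /eqP;
     rewrite addn_eq0 => /andP[_ /eqP qt]; apply/admissibleP; exists t.
have aq' : admissible q'.
  by have /admissibleP[t] := apq'; rewrite ptype_cat => /eqP;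
     rewrite addn_eq0 => /andP[_ /eqP qt]; apply/admissibleP; exists t.
apply: (ptype0_nil (P := fun z _ => w = z) (p := p)) => // t.
have := ptype_unique quiverQ apq aq' t; have := ptype_unique quiverQ apq' aq t.
by rewrite !ptype_cat; lia.
Qed.

Lemma mem_region (w : Q) u :
  reflect (is_shadow D (val u) w) (u \in region H D w).
Proof. by rewrite inE; apply: asboolP. Qed.

Lemma shadow_region (w : D) u : u \in region H D (val w) ->
  shadow D (val u) = Some w.
Proof.
move=> /mem_region uw; rewrite /shadow; case: pickP => [w' /asboolP uw'|/(_ w)].
  by congr Some; apply/val_inj/(is_shadow_unique uw' uw).
by move=> /asboolP.
Qed.

(** The component of [VDelta_map] at the vertex [w]. *)
Definition region_map (w : Q) (s : V w) : dsum (fun u : H => V (val u)) :=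
  dsum_of (fun u : H =>
    if u \in region H D w then path_map V (gam w (val u)) s else 0).

Fact region_map_linear (w : Q) : linear (@region_map w).
Proof.
move=> a s t; apply/dsumP=> u; rewrite linearP /= !dsum_ofE.
by case: ifP => _; rewrite ?linearP // scaler0 addr0.
Qed.
HB.instance Definition _ w :=
  GRing.isLinear.Build K (V w) _ _ (@region_map w) (@region_map_linear w).

Hypothesis DH : forall w : D, val w \in H.
Hypothesis shadowed : forall u, exists w : D, u \in region H D (val w).

Lemma sum_region_map (f : forall w : D, V (val w)) (w : D) u :
  u \in region H D (val w) ->
  dsum_proj u (\sum_(w : D) region_map (f w)) =
  path_map V (gam (val w) (val u)) (f w).
Proof.
move=> uw; rewrite linear_sum (bigD1 w) //= dsum_ofE uw.
rewrite big1 ?addr0 // => w' ww'.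
rewrite dsum_ofE ifF //; apply: contraNF ww' => uw'.
by have := shadow_region uw; rewrite (shadow_region uw') => -[->].
Qed.

Lemma VDelta_mapE (s : VDelta V H gam D) :
  VDelta_map s = \sum_(w : D) region_map (vsval (dsum_proj w s)).
Proof.
apply/dsumP=> u; have [w uw] := shadowed u.
by rewrite (sum_region_map _ uw) dsum_ofE (shadow_region uw).
Qed.

(** As the regions partition [H], the space of the polygon splits into one
    summand for each of its vertices, and so does its part supported on [I]. *)
Lemma WDelta_cap_dsum_on I :
  (WDelta V H gam D :&: dsum_on _ I =
   \sum_(w : D) linfun (@region_map (val w)) @:
      common_ker V gam (val w) (~: (I :&: region H D (val w))))%VS.
Proof.
apply/vspaceP=> y; apply/memv_capP/memv_sumP => [[/memv_imgP[s _ ->]]|].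
  rewrite lfunE /= => /mem_dsum_on sI.
  exists (fun w => region_map (vsval (dsum_proj w s))) => [w _|].
    rewrite -[region_map _]lfunE memv_img //; apply/mem_common_ker=> u.
    rewrite in_setC in_setI negb_and => /orP[uI|uw]; last first.
      by have /mem_common_ker := subvsP (dsum_proj w s); apply; rewrite in_setC.
    have [uw|Nuw] := boolP (u \in region H D (val w)); last first.
      by have /mem_common_ker := subvsP (dsum_proj w s); apply; rewrite in_setC.
    have := sI u uI.
    by rewrite VDelta_mapE (sum_region_map _ uw) memv_ker => ->.
  exact: VDelta_mapE.
case=> ys yw ->.
have ex w : exists s,
    s \in common_ker V gam (val w) (~: (I :&: region H D (val w))) /\
    ys w = region_map s.
  by have /memv_imgP[s sw ->] := yw w isT; exists s; rewrite lfunE.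
pose f w := sval (cid (ex w)).
have fw w :
    f w \in common_ker V gam (val w) (~: (I :&: region H D (val w))).
  exact: (svalP (cid (ex w))).1.
have ysE w : ys w = region_map (f w) by exact: (svalP (cid (ex w))).2.
rewrite (eq_bigr _ (fun w _ => ysE w)); split.
  pose s : VDelta V H gam D := dsum_of (fun w => vsproj _ (f w)).
  have -> : \sum_(w : D) region_map (f w) =
      linfun (@VDelta_map _ _ _ V H gam D) s.
    rewrite lfunE /= VDelta_mapE; apply: eq_bigr => w _; congr region_map.
    rewrite dsum_ofE vsprojK //; apply/mem_common_ker=> u.
    rewrite in_setC => uw; have /mem_common_ker := fw w; apply.
    by rewrite in_setC in_setI negb_and uw orbT.
  by rewrite memv_img // memvf.
apply/mem_dsum_on=> u uI; have [w uw] := shadowed u.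
rewrite (sum_region_map _ uw); apply/eqP; rewrite -memv_ker.
by have /mem_common_ker := fw w; apply; rewrite in_setC in_setI negb_and uI.
Qed.

(** The summands are independent because they have disjoint supports, and the
    maps onto them are injective because the vertices of [D] belong to [H]. *)
Lemma mu_polygonE I : mu_polygon R V gam D I =
  \sum_(w : D) mu_vertex R V gam (val w) (I :&: region H D (val w)).
Proof.
rewrite /mu_polygon /mu_of WDelta_cap_dsum_on -natr_sum; congr (_ %:R).
have /directvP -> : directv (\sum_(w : D) linfun (@region_map (val w)) @:
      common_ker V gam (val w) (~: (I :&: region H D (val w))))%VS.
  apply/directv_sum_independent => ys yw sum0 w _.
  have ex w' : exists s, ys w' = @region_map (val w') s.
    by have /memv_imgP[s _ ->] := yw w' isT; exists s; rewrite lfunE.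
  pose f w' := sval (cid (ex w')).
  have ysE w' : ys w' = region_map (f w') by exact: (svalP (cid (ex w'))).
  rewrite ysE; apply/dsumP=> u; rewrite dsum_ofE linear0; case: ifP => // uw.
  rewrite -(sum_region_map _ uw) -(eq_bigr _ (fun w _ => ysE w)) sum0.
  exact: linear0.
apply: eq_bigr => w _; apply: limg_dim_eq; apply/eqP; rewrite -subv0.
apply/subvP=> s /memv_capP[/mem_common_ker sI].
rewrite memv_ker lfunE /= => /eqP s0.
rewrite -(common_ker_setT (DH w)); apply/mem_common_ker=> u _.
have [uw|Nuw] := boolP (u \in region H D (val w)); last first.
  by apply: sI; rewrite in_setC in_setI negb_and Nuw orbT.
have := congr1 (dsum_proj u) s0.
by rewrite dsum_ofE uw linear0 memv_ker => ->.
Qed.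

End PolygonSpace.

End VertexPolytope.

(** * The polygon of a face *)

Section FacePolygon.
Variables (R : realType) (K : fieldType) (n : nat) (Q : typed_quiver n).
Variables (V : representation K Q) (H : {fset Q}).
Variable gam : forall v u : Q, qpath v u.
Hypotheses (quiverQ : Zn_quiver Q) (netV : linked_net V) (exactV : exact_net V).
Hypotheses (nontrivV : nontrivial_net V) (fingenV : finitely_generated V).
Hypothesis minH : forall u, min_generators V u <-> u \in H.
Hypothesis adm_gam : forall v u, v \in H -> u \in H -> admissible (gam v u).
Variables (v : Q) (vH : v \in H) (m : nat) (pi : m.-tuple {set H}).
Hypothesis partpi : ordered_partition pi.
Variable q : {ffun H -> R}.
Hypotheses (qP : polytope (splitting (mu_vertex R V gam v) pi) q)
  (q_gt0 : forall u, (0 < q u)%R).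
Implicit Types (u : H) (A : {set H}).

Local Notation E u := (Ess (gam v (val u))).
Local Notation part k := (nth set0 pi k).

(** The arrow types used on the way from [v] to every generator beyond the first
    [k] blocks of the partition, and the vertex they lead to from [v]. *)
Definition flag_Ess k : {set 'I_n.+1} := common_Ess gam v (~: flag pi k).
Definition flag_end k : Q := set_end quiverQ v (flag_Ess k).

Local Notation J := flag_Ess.
Local Notation x := flag_end.
Local Notation sigma k := (set_path quiverQ v (J k)).

Lemma flag_Ess0 : J 0 = set0.
Proof. by rewrite /J flag0 setC0 common_EssT. Qed.

Lemma flag_Ess_full : J m = setT.
Proof. by rewrite /J partition_flag_full // setCT /common_Ess big_set0. Qed.

Lemma flag_EssS j k : j <= k -> J j \subset J k.
Proof. by move=> jk; apply: common_EssS; rewrite setCS flag_sub. Qed.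

Lemma flag_Ess_sub k u : u \notin flag pi k -> J k \subset E u.
Proof.
by move=> uF; rewrite -common_Ess1; apply: common_EssS; rewrite sub1set in_setC.
Qed.

Lemma lker_sigma k :
  lker (path_map V (sigma k)) = common_ker V gam v (~: flag pi k).
Proof. by rewrite (common_kerE quiverQ). Qed.

Lemma lker_gam u :
  lker (path_map V (gam v (val u))) = set_ker V quiverQ v (E u).
Proof. by apply: ker_set_ker => //; apply: adm_gam (valP u). Qed.

(** Otherwise [u] could be removed from the flag without changing the value
    of [mu_vertex], which equals [q] on the flag, although [q u] is positive. *)
Lemma flag_ker_not_sub k u : k <= m -> u \in flag pi k ->
  ~~ (lker (path_map V (sigma k)) <= lker (path_map V (gam v (val u))))%VS.
Proof.
move=> km uF; apply/negP=> sub.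
have mu0 := mu_vertex0 R quiverQ netV exactV adm_gam vH.
have super A B := mu_vertex_super R quiverQ netV exactV adm_gam A B vH.
have full : flag pi (size pi) = setT by rewrite size_tuple partition_flag_full.
have qF := polytope_splitting_flag mu0 super full qP (k := k).
rewrite size_tuple in qF; have {}qF := qF km.
have := polytope_splitting_ge mu0 super full qP (flag pi k :\ u).
have -> : mu_vertex R V gam v (flag pi k :\ u) =
    mu_vertex R V gam v (flag pi k).
  rewrite /mu_vertex; congr (\dim _)%:R%R.
  rewrite setDE setCI setCK !(common_kerE quiverQ) // common_EssU common_Ess1.
  rewrite set_kerI // -lker_gam; exact/capv_idPl.
by rewrite -qF (big_setD1 u) //= gerDr leNgt q_gt0.
Qed.

Lemma flag_Ess_not_sub k u : k <= m -> u \in flag pi k -> ~~ (J k \subset E u).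
Proof.
move=> km uF; apply: contra (flag_ker_not_sub km uF) => sub.
by rewrite lker_gam; apply: set_kerS.
Qed.

(** The type [t] shows both that the flag types increase strictly and that the
    vertex [flag_end k] is the shadow of [u]. *)
Lemma part_witness k u : k < m -> u \in part k ->
  exists t, [/\ t \in J k.+1, t \notin E u & t \notin J k].
Proof.
move=> km uk.
have /fintype.subsetPn[t tJ tE] : ~~ (J k.+1 \subset E u).
  by apply: flag_Ess_not_sub => //; rewrite flagS inE uk orbT.
have /flag_Ess_sub/fintype.subsetP sub :=
  partition_nth_flag partpi (leqnn k) uk.
by exists t; split=> //; apply: contra tE; apply: sub.
Qed.

Lemma flag_Ess_strict k : k < m -> exists2 t, t \in J k.+1 & t \notin J k.
Proof.
move=> km; have [u uk] := partition_nonempty partpi (Ordinal km).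
by have [t []] := part_witness km uk; exists t.
Qed.

Lemma flag_Ess_proper k : k < m -> J k != setT.
Proof.
by move=> /flag_Ess_strict[t _]; apply: contraNneq => ->; rewrite in_setT.
Qed.

Lemma admissible_sigma k : k < m -> admissible (sigma k).
Proof. by move=> /flag_Ess_proper; rewrite admissible_set_path. Qed.

Lemma simple_sigma k : simple_path (sigma k).
Proof. by apply: (simple_of_set (J := J k)) => t; apply: ptype_set_path. Qed.

Lemma flag_end0 : x 0 = v.
Proof.
apply/esym/(path_end quiverQ (p := qnil v) (q := sigma 0) (c := 0)) => t.
by rewrite ptype_set_path flag_Ess0 inE.
Qed.

Lemma flag_end_forward j k : j <= k ->
  exists p : qpath (x j) (x k), forall t, ptype p t = (t \in J k :\: J j).
Proof.
move=> jk.
apply: (path_between quiverQ (p := sigma j) (q := sigma k) (c := 0)) => t.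
rewrite !ptype_set_path inE addn0.
by case: (boolP (t \in J j)) => // /(fintype.subsetP (flag_EssS jk)) ->.
Qed.

Lemma flag_end_backward j k : k <= j ->
  exists p : qpath (x j) (x k), forall t, ptype p t = (t \notin J j :\: J k).
Proof.
move=> kj.
apply: (path_between quiverQ (p := sigma j) (q := sigma k) (c := 1)) => t.
rewrite !ptype_set_path inE.
have := fintype.subsetP (flag_EssS kj) t.
by case: (t \in J k) => [/(_ isT) ->|_] //; case: (t \in J j).
Qed.

Lemma flag_end_neq j k : j < k -> k < m -> x j != x k.
Proof.
move=> jk km; have [p pE] := flag_end_forward (ltnW jk).
have [t tJ tN] := flag_Ess_strict (ltn_trans jk km).
have ap : admissible p.
  rewrite admissible_Ess (Ess_of_set pE).
  apply: contraNneq (flag_Ess_proper km) => JT; apply/eqP/setP=> s.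
  have := in_setT s.
  by rewrite -{1}JT !inE => /andP[_ ->].
apply/eqP=> /(ptype_loop quiverQ t)/(_ ap).
by rewrite pE inE tN (fintype.subsetP (flag_EssS jk)).
Qed.

(** An admissible path from [v] to a generator beyond the first [k] blocks can
    be taken through [flag_end k]. *)
Lemma admissible_beyond k u (p : qpath (x k) (val u)) : k < m ->
  u \notin flag pi k -> admissible p -> admissible (qcat (sigma k) p).
Proof.
move=> km uF ap; have ag := adm_gam vH (valP u).
have [|g gE] := path_between quiverQ (p := sigma k) (q := gam v (val u))
    (f := fun t => (ptype (gam v (val u)) t - (t \in J k))%N) (c := 0).
  move=> t; rewrite ptype_set_path addn0.
  have := fintype.subsetP (flag_Ess_sub uF) t; rewrite mem_Ess.
  by case: (t \in J k) => [/(_ isT)|_] /=; lia.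
have /admissibleP[t gt0] := ag.
have ag' : admissible g by apply/admissibleP; exists t; rewrite gE gt0.
apply/admissibleP; exists t; rewrite ptype_cat ptype_set_path.
rewrite (ptype_unique quiverQ ap ag') gE gt0 addn0.
by have := fintype.subsetP (flag_Ess_sub uF) t; rewrite mem_Ess gt0;
  case: (t \in J k) => // /(_ isT).
Qed.

Lemma return_path k :
  exists p : qpath (x k) v, forall t, ptype p t = (t \notin J k).
Proof.
apply: (path_between quiverQ (p := sigma k) (q := qnil v) (c := 1)) => t.
by rewrite ptype_set_path; case: (t \in J k).
Qed.

(** For a generator in the first [k] blocks it is the other way round: an
    admissible path from [flag_end k] can be taken through [v]. *)
Lemma admissible_return k (p : qpath (x k) v) u : k <= m ->
  (forall t, ptype p t = (t \notin J k)) -> u \in flag pi k ->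
  admissible (qcat p (gam v (val u))).
Proof.
move=> km pE uF; have /fintype.subsetPn[t tJ tE] := flag_Ess_not_sub km uF.
apply/admissibleP; exists t; rewrite ptype_cat pE tJ.
by move: tE; rewrite mem_Ess lt0n negbK => /eqP ->.
Qed.

Lemma return_exact k (p : qpath (x k) v) : 0 < k -> k < m ->
  (forall t, ptype p t = (t \notin J k)) ->
  limg (path_map V p) = lker (path_map V (sigma k)) /\
  limg (path_map V (sigma k)) = lker (path_map V p).
Proof.
move=> k0 km pE; have xv : x k != v by rewrite -flag_end0 eq_sym flag_end_neq.
have pE' t : ptype p t = (t \in ~: J k) by rewrite in_setC pE.
have m0 : 0 < m by apply: ltn_trans km.
have ap : admissible p.
  rewrite admissible_Ess (Ess_of_set pE').
  have [t tJ _] := flag_Ess_strict m0.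
  apply: contraTneq (fintype.subsetP (flag_EssS k0) t tJ).
  by move=> JT; have := in_setT t; rewrite -{1}JT in_setC.
by split; apply: limg_lker_exact => //; rewrite ?admissible_sigma ?simple_sigma
  1?eq_sym // (simple_of_set pE').
Qed.

Lemma mem_flag_v k : 0 < k -> k < m -> [` vH]%fset \in flag pi k.
Proof.
move=> k0 km; apply: contraT => /flag_Ess_sub.
have [t tJ _] := flag_Ess_strict (ltn_trans k0 km).
move=> /fintype.subsetP/(_ t (fintype.subsetP (flag_EssS k0) t tJ)).
by rewrite mem_Ess (ptype_loop quiverQ t _ (adm_gam vH vH)).
Qed.

(** A zero map from [flag_end k] to a generator [u] would force the kernel of a
    flag into the kernel of the map from [v] to [u]. *)
Lemma flag_end_generator k : k < m -> x k \in H.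
Proof.
move=> km; apply: (minH _).1.
apply: (min_generators_nonzero quiverQ netV nontrivV fingenV).
move=> u0 p /minH uH ap; pose u : H := [` uH]%fset; apply/negP=> full.
have [uF|uF] := boolP (u \in flag pi k).
  have [k0|k0] := posnP k; first by rewrite k0 flag0 inE in uF.
  have [g gE] := return_path k.
  have /negP[] := flag_ker_not_sub (ltnW km) uF.
  rewrite -(return_exact k0 km gE).1; apply/subvP=> _ /memv_imgP[s _ ->].
  rewrite -mem_lker_cat (ker_adm netV _ ap) ?(subvP full) ?memvf //.
  exact: admissible_return (ltnW km) gE uF.
(* Beyond the first [k] blocks the map from [v] to [u] would vanish as well. *)
have uT : u \in flag pi m by rewrite partition_flag_full // in_setT.
have /negP[] := flag_ker_not_sub (leqnn m) uT; apply: subv_trans (subvf _) _.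
have aq := admissible_beyond km uF ap.
rewrite (ker_adm netV (adm_gam vH uH) aq); apply/subvP=> s _.
by rewrite mem_lker_cat (subvP full) // memvf.
Qed.

(** The face of [v] along the flag is, block by block, governed by the vertices
    of the polygon: the map from [v] to [flag_end k] has the kernel of the flag
    as kernel, and its image is cut out by the generators of the flag. *)
Lemma dim_common_ker_part k A : k < m -> A \subset part k ->
  (\dim (common_ker V gam v (~: (A :|: flag pi k))) =
   \dim (common_ker V gam v (~: flag pi k)) +
   \dim (common_ker V gam (x k) (~: A)))%N.
Proof.
move=> km Ak; set W := common_ker V gam v _; set f := path_map V (sigma k).
have xH := flag_end_generator km; rewrite -lker_sigma -/f.
have beyond u s : u \notin flag pi k ->
    (s \in lker (path_map V (gam v (val u)))) =
    (f s \in lker (path_map V (gam (x k) (val u)))).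
  move=> uF; rewrite -mem_lker_cat (ker_adm netV (adm_gam vH (valP u))
    (admissible_beyond km uF (adm_gam xH (valP u)))) //.
have fW : (lker f <= W)%VS.
  rewrite lker_sigma; apply/subvP=> s /mem_common_ker sF.
  apply/mem_common_ker=> u uA.
  by apply: sF; move: uA; rewrite !in_setC in_setU negb_or => /andP[].
rewrite -(limg_ker_dim f W) (capv_idPr fW); congr (_ + \dim _).
apply: subv_anti; apply/andP; split; apply/subvP=> y; last first.
  move=> /mem_common_ker yA.
  have /memv_imgP[s _ ys] : y \in limg f.
    have [k0|k0] := posnP k.
      rewrite (map_ptype0 V _).2 ?memvf // => t.
      by rewrite ptype_set_path k0 flag_Ess0 inE.
    have [g gE] := return_path k; rewrite (return_exact k0 km gE).2.
    (* The vertex [v] lies in the flag, so [y] vanishes at [v]. *)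
    have vF := mem_flag_v k0 km.
    have : y \in lker (path_map V (gam (x k) v)).
      apply: (yA [` vH]%fset); rewrite in_setC; apply: contraL vF.
      by move/(fintype.subsetP Ak)/(partition_nth_flag partpi (leqnn k)).
    have aqg := admissible_return (ltnW km) gE vF.
    rewrite -(ker_adm netV aqg (adm_gam xH vH)) mem_lker_cat.
    have [|-> _] := @map_ptype0 _ _ _ V _ _ (gam v v);
      last by rewrite memv0 memv_ker.
    by move=> t; apply: (ptype_loop quiverQ t erefl); apply: adm_gam.
  rewrite ys memv_img //; apply/mem_common_ker=> u.
  rewrite in_setC in_setU negb_or.
  by move=> /andP[uA uF]; rewrite beyond // -ys yA // in_setC.
move=> /memv_imgP[s /mem_common_ker sW ->]; apply/mem_common_ker=> u.
rewrite in_setC => uA.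
have [uF|uF] := boolP (u \in flag pi k); last first.
  by rewrite -beyond // sW // in_setC in_setU negb_or uA.
have [k0|k0] := posnP k; first by rewrite k0 flag0 inE in uF.
have [g gE] := return_path k.
have agu := admissible_return (ltnW km) gE uF.
rewrite (ker_adm netV (adm_gam xH (valP u)) agu) mem_lker_cat.
have : f s \in lker (path_map V g).
  by rewrite -(return_exact k0 km gE).2 memv_img ?memvf.
by rewrite memv_ker => /eqP ->; apply: mem0v.
Qed.

(** The vertices of the polygon, in the order starting from [v]. *)
Definition flag_ends : m.-tuple Q := [tuple x k | k < m].
Definition flag_polygon : {fset Q} := [fset w in (flag_ends : seq Q)]%fset.

Lemma tnth_flag_ends (k : 'I_m) : tnth flag_ends k = x k.
Proof. exact: tnth_mktuple. Qed.

Lemma flag_polygonP w : reflect (exists k : 'I_m, w = x k) (w \in flag_polygon).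
Proof.
rewrite in_fset; apply: (iffP (tnthP _ _)) => -[k wk]; exists k.
  by rewrite wk tnth_flag_ends.
by rewrite tnth_flag_ends.
Qed.

Lemma flag_end_inj j k : j < m -> k < m -> x j = x k -> j = k.
Proof.
move=> jm km /eqP; case: (ltngtP j k) => // [jk|kj].
  by rewrite (negPf (flag_end_neq jk km)).
by rewrite eq_sym (negPf (flag_end_neq kj jm)).
Qed.

Lemma flag_ends_uniq : uniq flag_ends.
Proof.
rewrite map_inj_uniq ?enum_uniq // => j k E.
exact/val_inj/(flag_end_inj (ltn_ord j) (ltn_ord k) E).
Qed.

Lemma flag_polygon_polygon : polygon m flag_polygon.
Proof.
split; first by rewrite card_fseq undup_id ?flag_ends_uniq // size_tuple.
move=> _ _ /flag_polygonP[j ->] /flag_polygonP[k ->] ne; split=> //.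
have [jk|/ltnW kj] := leqP j k.
  have [p pE] := flag_end_forward jk; exists p.
  exact: (simple_of_set (J := J k :\: J j)).
have [p pE] := flag_end_backward kj; exists p.
by apply: (simple_of_set (J := ~: (J j :\: J k))) => t; rewrite in_setC pE.
Qed.

Lemma part_shadow k u : k < m -> u \in part k ->
  is_shadow flag_polygon (val u) (x k).
Proof.
move=> km uk; have xkH := flag_end_generator km.
split; first by apply/flag_polygonP; exists (Ordinal km).
move=> _ /flag_polygonP[j ->].
have [t [tJ tE tN]] := part_witness km uk.
have [p pt] : exists p : qpath (x j) (x k), ptype p t = 0.
  have [jk|kj] := leqP j k.
    have [p pE] := flag_end_forward jk; exists p.
    by rewrite pE inE (negPf tN) andbF.
  have [p pE] := flag_end_backward (ltnW kj); exists p.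
  by rewrite pE inE tN (fintype.subsetP (flag_EssS kj)).
exists p, (gam (x k) (val u)); apply/admissibleP; exists t.
rewrite ptype_cat pt.
have ax := adm_gam xkH (valP u).
have uF := partition_nth_flag partpi (leqnn k) uk.
have aq := admissible_beyond km uF ax.
have := ptype_unique quiverQ aq (adm_gam vH (valP u)) t.
rewrite ptype_cat; move: tE; rewrite mem_Ess lt0n negbK => /eqP ->.
by move/eqP; rewrite addn_eq0 => /andP[_ /eqP].
Qed.

Lemma region_flag_end k : k < m -> region H flag_polygon (x k) = part k.
Proof.
move=> km; apply/setP=> u; apply/mem_region/idP => [uk|];
  last exact: part_shadow.
have [j uj] := partition_mem partpi u.
have := is_shadow_unique quiverQ uk (part_shadow (ltn_ord j) uj).
by move/(flag_end_inj km (ltn_ord j)) => ->.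
Qed.

Lemma flag_ends_oriented : oriented_polygon flag_ends.
Proof.
exists [tuple (J k.+1 :\: J k)%SET | k < m]; split; last first.
  move=> i j ji; rewrite tnth_mktuple !tnth_flag_ends ji.
  have [p pE] := flag_end_forward (leqnSn i); exists p.
  by split; [apply: simple_of_set pE|apply: Ess_of_set].
split=> [k|j k|t].
- rewrite tnth_mktuple; apply/set0Pn.
  by have [t tJ tN] := flag_Ess_strict (ltn_ord k); exists t; rewrite inE tN.
- wlog jk : j k / j < k.
    move=> gen; rewrite neq_ltn => /orP[jk|kj].
      by apply: gen; rewrite ?neq_ltn ?jk.
    by rewrite disjoint_sym; apply: gen; rewrite ?neq_ltn ?kj.
  move=> _; rewrite !tnth_mktuple -setI_eq0; apply/eqP/setP=> t.
  have := fintype.subsetP (flag_EssS jk) t; rewrite !inE.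
  by case: (t \in J j.+1) => [/(_ isT) ->|_]; rewrite ?andbF.
have ex : exists k, t \in J k by exists m; rewrite flag_Ess_full inE.
case: (ex_minnP ex) => -[|k]; first by rewrite flag_Ess0 inE.
move=> tk min; have km : k < m by apply: min; rewrite flag_Ess_full inE.
exists (Ordinal km); rewrite tnth_mktuple inE tk andbT.
by apply/negP=> /min; rewrite ltnn.
Qed.

Lemma partition_size_gt0 : 0 < m.
Proof.
have [k _] := partition_mem partpi [` vH]%fset.
exact: leq_ltn_trans (ltn_ord k).
Qed.

Lemma flag_polygon_induced : induced_partition flag_polygon v pi.
Proof.
exists flag_ends; split.
- exact: flag_ends_uniq.
- by move=> w; rewrite in_fset.
- have m0 := partition_size_gt0.
  have : nth v flag_ends 0 = v.
    by rewrite -(tnth_nth v _ (Ordinal m0)) tnth_flag_ends flag_end0.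
  have := size_tuple flag_ends.
  by case: (tval flag_ends) => [|w s] /= => [m00|_ ->] //; rewrite -m00 in m0.
- exact: flag_ends_oriented.
apply: eq_from_tnth => k.
by rewrite tnth_map tnth_flag_ends region_flag_end // -tnth_nth.
Qed.

Local Open Scope ring_scope.

(** By [mu_polygonE] the right-hand side is a sum over the blocks, and
    [dim_common_ker_part] identifies its terms with those of the splitting. *)
Lemma splitting_mu_polygon :
  splitting (mu_vertex R V gam v) pi = mu_polygon R V gam flag_polygon.
Proof.
apply/funext=> I.
have inH (w : flag_polygon) : val w \in H.
  by have /flag_polygonP[k ->] := valP w; apply: flag_end_generator.
have shadowed u : exists w : flag_polygon, u \in region H flag_polygon (val w).
  have [k uk] := partition_mem partpi u.
  have xD : x k \in flag_polygon by apply/flag_polygonP; exists k.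
  by exists [` xD]%fset; rewrite region_flag_end.
rewrite (mu_polygonE R quiverQ netV exactV adm_gam inH shadowed) /splitting.
pose term j := mu_vertex R V gam v (I :&: flag pi j.+1 :|: flag pi j)
  - mu_vertex R V gam v (flag pi j).
rewrite -(big_mkord xpredT term) size_tuple big_mkord.
rewrite -(big_seq_fsetE _ _ xpredT
  (fun w => mu_vertex R V gam w (I :&: region H flag_polygon w))) /=.
have perm : perm_eq flag_polygon (flag_ends : seq Q).
  apply: uniq_perm; rewrite ?fset_uniq ?flag_ends_uniq // => w.
  by rewrite in_fset.
rewrite (perm_big _ perm) big_tuple; apply: eq_bigr => k _.
rewrite tnth_flag_ends region_flag_end //.
have -> : term k = mu_vertex R V gam v (I :&: part k :|: flag pi k)
    - mu_vertex R V gam v (flag pi k).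
  by rewrite /term flagS setIUr (setUC (I :&: _)) -setUA
    (setUidPr (subsetIr I _)).
rewrite /mu_vertex dim_common_ker_part ?subsetIr // natrD addrAC subrr.
exact: add0r.
Qed.

End FacePolygon.

Local Open Scope classical_set_scope.
Local Open Scope fset_scope.

Theorem proposition3p5 (R : realType) (K : fieldType) (n r : nat)
    (Q : typed_quiver n) (V : representation K Q)
    (quiverQ : Zn_quiver Q)
    (netV : linked_net V) (exactV : exact_net V)
    (nontrivV : nontrivial_net V) (fingenV : finitely_generated V)
    (dimV : of_dimension V r.+1)
    (H : {fset Q}) (minH : [set` H] = min_generators V)
    (gam : forall v u : Q, qpath v u)
    (adm_gam : forall v u, v \in H -> u \in H -> admissible (gam v u))
    (v : Q) (vH : v \in H)
    (m : nat) (pi : m.-tuple {set H}) (partpi : ordered_partition pi)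
    (meet : polytope (splitting (mu_vertex R V gam v) pi)
            `&` relative_interior (Omega R H r.+1) !=set0) :
  exists D : {fset Q},
    [/\ polygon m D, D `<=` H, v \in D, induced_partition D v pi
      & polytope (splitting (mu_vertex R V gam v) pi)
        = polytope (mu_polygon R V gam D)].
Proof.
have [q [qP qO]] := meet.
have q0 u : (0 < q u)%R by apply: relative_interior_Omega_gt0 qO.
have memH u : min_generators V u <-> u \in H by rewrite -minH.
exists (flag_polygon gam quiverQ v pi); split.
- exact: (flag_polygon_polygon quiverQ netV exactV adm_gam vH partpi qP q0).
- apply/fsubsetP=> _ /flag_polygonP[k ->].
  exact: (flag_end_generator quiverQ netV exactV nontrivV fingenV memH
    adm_gam vH partpi qP q0).
- apply/flag_polygonP.
  exists (Ordinal (partition_size_gt0 vH partpi)).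
  by rewrite (flag_end0 quiverQ adm_gam vH).
- exact: (flag_polygon_induced quiverQ netV exactV nontrivV fingenV memH
    adm_gam vH partpi qP q0).
by rewrite (splitting_mu_polygon quiverQ netV exactV nontrivV fingenV memH
  adm_gam vH partpi qP q0).
Qed.
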